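(* Let $(A,B)$ be controllable, with $A\in\mathbb{R}^{n\times n}$, $B\in\mathbb{R}^{n\times m}$, and let $L>0$. Let $\{x_{[0,T-1]},u_{[0,T-1]}\}$ be a state/input pair generated by the noise-free system $x(t+1)=Ax(t)+Bu(t)$ (for $t=0,\dots,T-2$), and assume that $u_{[0,T-1]}$ is persistently exciting of order at least $n+L$. Then $$\left\{\begin{bmatrix}\mathbf{\Phi}_x(:,0)\\ \mathbf{\Phi}_u(:,0)\end{bmatrix}\in\mathbb{R}^{(nL+mL)\times n} : \begin{bmatrix} I-\mathcal{Z}\mathcal{A} & -\mathcal{Z}\mathcal{B}\end{bmatrix}\begin{bmatrix}\mathbf{\Phi}_x(:,0)\\ \mathbf{\Phi}_u(:,0)\end{bmatrix}=I(:,0)\right\} =\left\{\begin{bmatrix}\mathcal{H}_L(x)\\ \mathcal{H}_L(u)\end{bmatrix}G : G\in\Gamma(x)\right\},$$ where $\Gamma(x)=\{G\in\mathbb{R}^{(T-L+1)\times n} : \mathcal{H}_1(x)G=I_n\}$.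
   Context: Hankel matrices: for a signal $\sigma_{[0,T-1]}=(\sigma(0),\dots,\sigma(T-1))$ with $\sigma(t)\in\mathbb{R}^p$, $\mathcal{H}_L(\sigma)=\mathcal{H}_L(\sigma_{[0,T-1]})\in\mathbb{R}^{pL\times(T-L+1)}$ is the matrix whose $(k,t)$ block ($0\le k\le L-1$, $0\le t\le T-L$) is $\sigma(t+k)$. Here $\mathcal{H}_1(x)$ denotes the first block row of $\mathcal{H}_L(x)$, i.e. $\mathcal{H}_1(x)=[x(0)\ x(1)\ \cdots\ x(T-L)]\in\mathbb{R}^{n\times(T-L+1)}$. Persistence of excitation: $\sigma_{[0,T-1]}$ is persistently exciting of order $K$ if $\mathcal{H}_K(\sigma_{[0,T-1]})$ has full rank; it is always assumed that $T\ge(p+1)K-1$, so this means full row rank $pK$. Operators: $\mathcal{A}=I_L\otimes A$, $\mathcal{B}=I_L\otimes B$; $\mathcal{Z}\in\mathbb{R}^{nL\times nL}$ is the block-downshift operator, with identity matrices $I_n$ along the first block subdiagonal and zeros elsewhere; $I(:,0)\in\mathbb{R}^{nL\times n}$ is the first block column of $I_{nL}$ (top block $I_n$, other blocks zero). The matrices $\mathbf{\Phi}_x(:,0)\in\mathbb{R}^{nL\times n}$, $\mathbf{\Phi}_u(:,0)\in\mathbb{R}^{mL\times n}$ represent the first block columns of the closed-loop system responses over the horizon $t=0,\dots,L-1$. *)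

(* Defs.v *)
From mathcomp Require Import all_boot all_order all_algebra.
From mathcomp Require Import classical_sets reals.
From mathcomp.real_closed Require Export mxtens.

Set Implicit Arguments.
Unset Strict Implicit.
Unset Printing Implicit Defensive.
Import GRing.Theory.
Local Open Scope ring_scope.
Local Open Scope classical_set_scope.

(* A finite signal sigma_[0,T-1] with values in R^p is a function
   nat -> 'cV[R]_p together with its length T; only its values at
   0, ..., T-1 are ever used. *)

Definition trajectory (R : realType) (n m : nat) (A : 'M[R]_n)
    (B : 'M[R]_(n, m)) (T : nat) (x : nat -> 'cV[R]_n) (u : nat -> 'cV[R]_m) :
    Prop :=
  forall t : nat, (t.+1 < T)%N -> x t.+1 = A *m x t + B *m u t.

Definition controllable (R : realType) (n m : nat) (A : 'M[R]_n)
    (B : 'M[R]_(n, m)) : Prop :=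
  forall x0 xf : 'cV[R]_n, exists (N : nat) (x : nat -> 'cV[R]_n)
    (u : nat -> 'cV[R]_m),
    [/\ trajectory A B N.+1 x u, x 0%N = x0 & x N = xf].

(* The row index i : 'I_(L * p) stands for the pair (block, component)
   mxtens_unindex i = (i %/ p, i %% p), the same row-major convention as in
   the Kronecker product *t. When L <= T the number of columns T.+1 - L is
   T - L + 1, and every time t + k which occurs is smaller than T. *)
Definition hankel (R : realType) (p L T : nat) (sigma : nat -> 'cV[R]_p) :
    'M[R]_(L * p, T.+1 - L) :=
  \matrix_(i < L * p, t < T.+1 - L)
    sigma (t + (mxtens_unindex i).1)%N (mxtens_unindex i).2 0.

(* First block row of hankel L T sigma, hence with T - L + 1 columns: it
   is not the depth-one Hankel matrix of the whole signal. *)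
Definition hankel1 (R : realType) (p L T : nat) (sigma : nat -> 'cV[R]_p) :
    'M[R]_(p, T.+1 - L) :=
  \matrix_(i < p, t < T.+1 - L) sigma t i 0.

(* The bound on T is the standing assumption under which full rank means full
   row rank. *)
Definition persistently_exciting (R : realType) (p T : nat)
    (sigma : nat -> 'cV[R]_p) (K : nat) : Prop :=
  ((p + 1) * K - 1 <= T)%N /\ \rank (hankel K T sigma) = (K * p)%N.

Definition blkdiag (R : realType) (L n m : nat) (M : 'M[R]_(n, m)) :
    'M[R]_(L * n, L * m) :=
  (1%:M : 'M[R]_L) *t M.

Definition downshift (R : realType) (L n : nat) : 'M[R]_(L * n) :=
  (\matrix_(i < L, j < L) (i == j.+1 :> nat)%:R) *t (1%:M : 'M[R]_n).

(* Columns 0, ..., n-1 of the identity matrix of size L * n. *)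
Definition id_blockcol0 (R : realType) (L n : nat) : 'M[R]_(L * n, n) :=
  \matrix_(i < L * n, j < n) (i == j :> nat)%:R.

Definition Gamma (R : realType) (n L T : nat) (x : nat -> 'cV[R]_n) :
    set 'M[R]_(T.+1 - L, n) :=
  [set G | hankel1 L T x *m G = 1%:M].

Arguments hankel {R p} L T sigma.
Arguments hankel1 {R p} L T sigma.
Arguments persistently_exciting {R p} T sigma K.
Arguments blkdiag {R} L {n m} M.
Arguments downshift R L n : clear implicits.
Arguments id_blockcol0 R L n : clear implicits.
Arguments Gamma {R n} L T x.

(* Main.v *)
Require Import Defs.
From mathcomp Require Import all_boot all_order all_algebra.
From mathcomp Require Import classical_sets reals.
From mathcomp Require Import zify.
Local Open Scope ring_scope.
Local Open Scope classical_set_scope.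
Import GRing.Theory.

Set Implicit Arguments.
Unset Strict Implicit.
Unset Printing Implicit Defensive.

(** The constraint says that each column of [Phi] is a trajectory of length
    [L], the initial state being the corresponding column of the identity.
    Two facts give the equality.

    First, windows of the data are trajectories ([hankel_dynamics]), so
    [H_L(x) G] and [H_L(u) G] solve the constraint up to the initial condition
    [H_1(x) G], which is the identity exactly when [G] lies in [Gamma].
    Conversely, [I - Z A] being injective ([shift_fixed_eq0]), a solution is
    determined by its input part.

    Secondly, every pair (initial state, input) is realised by some [G]: the
    matrix with block rows [H_1(x)] and [H_L(u)] has full row rank, which is
    the fundamental lemma of Willems ([data_row_free]).  Its proof runs as
    follows.  Let [xi x(t) + \sum_(k < L) eta_k u(t + k)] vanish at all
    available times [t].  Writing the same functional at time [t + i] in terms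
    of [x(t)] gives [xi A^i x(t)] plus a combination of [u(t), ...,
    u(t + n + L - 1)] whose coefficients, from the latest input backwards, are
    the entries from position [i] on of a single sequence ([response_seq]):
    [n] zeros, then [eta] reversed, then the Markov parameters
    [xi A^j B].  The combination of these identities for [i <= n] by the
    coefficients of the characteristic polynomial of [A] kills the state by
    the theorem of Cayley and Hamilton; persistency of excitation of order
    [n + L] then kills all input coefficients.  So the sequence satisfies the
    linear recurrence of the characteristic polynomial, and its first [n] terms
    are zero: it is zero.  Hence [eta = 0], and [xi A^j B = 0] for all
    [j], so [xi = 0] by controllability. *)

Lemma sum_mxtens_index (R : nmodType) (a b : nat) (F : 'I_(a * b)%N -> R) :
  \sum_i F i = \sum_(k < a) \sum_(l < b) F (mxtens_index (k, l)).
Proof.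
rewrite (reindex (@mxtens_index a b)) /=; last first.
  by exists (@mxtens_unindex a b) => ? _;
    rewrite ?mxtens_indexK ?mxtens_unindexK.
by rewrite pair_bigA; apply: eq_bigr => -[].
Qed.

(** * Annihilators of the data *)

(** The characteristic polynomial, in a form that also makes sense for
    [n = 0]. *)
Lemma monic_annihilator (R : realType) (n : nat) (A : 'M[R]_n) :
  exists2 c : nat -> R, c n = 1 & \sum_(i < n.+1) c i *: A ^+ i = 0.
Proof.
case: n A => [|n] A; first by exists (fun=> 1) => //; rewrite [LHS]flatmx0 [RHS]flatmx0.
exists (fun i => (char_poly A)`_i).
  have /monicP := char_poly_monic A.
  by rewrite lead_coefE size_char_poly.
have := Cayley_Hamilton A.
rewrite -[char_poly A in X in X -> _]coefK poly_def size_char_poly.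
rewrite rmorph_sum /= => CH; rewrite -[RHS]CH.
by apply: eq_bigr => i _; rewrite linearZ rmorphXn /= horner_mx_X.
Qed.

(** Every [xi A^j x(t)] vanishes along trajectories from the origin, and these
    reach all states. *)
Lemma markov_eq0 (R : realType) (n m : nat) (A : 'M[R]_n) (B : 'M[R]_(n, m))
    (xi : 'rV[R]_n) :
  controllable A B -> (forall j, xi *m A ^+ j *m B = 0) -> xi = 0.
Proof.
move=> hAB markov0; apply/rowP => q; rewrite mxE.
have [N [x [u [hxu x0 xN]]]] := hAB 0 (delta_mx q 0).
suff reach t : (t <= N)%N -> forall j, xi *m A ^+ j *m x t = 0.
  have /matrixP/(_ 0 0) := reach N (leqnn N) 0%N.
  by rewrite xN expr0 mulmx1 -colE !mxE.
elim: t => [|t IHt] lt j; first by rewrite x0 mulmx0.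
rewrite hxu // mulmxDr !mulmxA markov0 mul0mx addr0.
by rewrite -[_ *m A]mulmxA -[A ^+ j *m A]exprSr IHt // ltnW.
Qed.

(** Only the first [N <= K] blocks of the kernel vector need be given, the
    others being taken to be zero: this is why excitation of order [K] implies
    excitation of all lower orders. *)
Lemma persistently_exciting_eq0 (R : realType) (p T K N : nat)
    (u : nat -> 'cV[R]_p) (h : nat -> 'rV[R]_p) :
  persistently_exciting T u K -> (N <= K)%N ->
  (forall t, (t < T.+1 - K)%N -> \sum_(k < N) h k *m u (t + k)%N = 0) ->
  forall k, (k < N)%N -> h k = 0.
Proof.
move=> [_ rkH] leNK h0 k ltkN.
have /row_free_inj injH : row_free (hankel K T u) by rewrite /row_free rkH.
pose v : 'rV[R]_(K * p) := \row_i
  (let ki := mxtens_unindex i in if (ki.1 < N)%N then h ki.1 0 ki.2 else 0).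
have v0 : v = 0.
  apply: injH; rewrite mul0mx; apply/rowP => t; rewrite !mxE.
  have /matrixP/(_ 0 0) := h0 t (ltn_ord t).
  rewrite summxE mxE => h0t; rewrite -[RHS]h0t.
  rewrite (big_ord_widen K (fun k : nat => (h k *m u (t + k)%N) 0 0)) //.
  rewrite [RHS]big_mkcond sum_mxtens_index /=.
  apply: eq_bigr => a _; case: ifP => ltaN; last first.
    by apply: big1 => b _; rewrite !mxE mxtens_indexK /= ltaN mul0r.
  rewrite mxE; apply: eq_bigr => b _.
  by rewrite !mxE mxtens_indexK /= ltaN.
apply/rowP => i; rewrite mxE.
have /rowP/(_ (mxtens_index (Ordinal (leq_trans ltkN leNK), i))) := v0.
by rewrite !mxE mxtens_indexK /= ltkN.
Qed.

(** The [n] leading zeros provide zero initial values for a recurrence of order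
    [n], and let one window length [n + L] serve for all shifts [i <= n] in
    [shifted_annihilator]. *)
Definition response_seq (R : realType) (n m : nat) (A : 'M[R]_n)
    (B : 'M[R]_(n, m)) (L : nat) (xi : 'rV[R]_n) (eta : nat -> 'rV[R]_m)
    (a : nat) : 'rV[R]_m :=
  if (a < n)%N then 0
  else if (a < n + L)%N then eta (n + L - 1 - a)%N
  else xi *m A ^+ (a - (n + L)) *m B.

(** Each use of the dynamics [x(t + 1) = A x(t) + B u(t)] appends the Markov
    parameter [xi A^i B] at the oldest input and moves the other coefficients
    one step. *)
Lemma shifted_annihilator (R : realType) (n m L T : nat) (A : 'M[R]_n)
    (B : 'M[R]_(n, m)) (x : nat -> 'cV[R]_n) (u : nat -> 'cV[R]_m)
    (xi : 'rV[R]_n) (eta : nat -> 'rV[R]_m) :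
  (0 < L)%N -> trajectory A B T x u ->
  (forall t, (t < T.+1 - L)%N ->
    xi *m x t + \sum_(k < L) eta k *m u (t + k)%N = 0) ->
  forall i t, (i <= n)%N -> (t + i < T.+1 - L)%N ->
    xi *m A ^+ i *m x t + \sum_(k < n + L)
      response_seq A B L xi eta (n + L - 1 - k + i) *m u (t + k)%N = 0.
Proof.
move=> L_gt0 hxu ann0.
elim=> [|i IHi] t lein ltiT.
  rewrite -[RHS](ann0 t) -1?[t]addn0 // expr0 mulmx1 !addn0; congr (_ + _).
  rewrite (big_ord_widen (n + L) (fun k : nat => eta k *m u (t + k)%N)) ?leq_addl //.
  rewrite [RHS]big_mkcond /=; apply: eq_bigr => k _; rewrite /response_seq.
  have := ltn_ord k; case: (ltnP k L) => ltkL ltk.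
    rewrite ifF ?ifT; [|lia|lia].
    by congr (eta _ *m _); lia.
  by rewrite ifT ?mul0mx //; lia.
have xS : x t.+1 = A *m x t + B *m u t by apply: hxu; lia.
rewrite -[RHS](IHi t.+1); [|lia|lia].
rewrite xS mulmxDr !mulmxA -[_ *m A *m _]mulmxA.
rewrite -[_ *m A ^+ i *m (A *m _)]mulmxA (mulmxA (A ^+ i)) -[A ^+ i *m A]exprSr mulmxA.
rewrite -addrA; congr (_ + _).
(* The first term on the left is the new Markov parameter; the last one on the
   right falls among the leading zeros, since [i < n]. *)
have [N defN] : exists N, (n + L = N.+1)%N by exists (n + L).-1; lia.
rewrite defN big_ord_recl big_ord_recr /= addn0.
rewrite [X in _ = _ + (_ + X)](_ : _ = 0); last first.
  by rewrite /response_seq ifT ?mul0mx //; lia.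
rewrite addr0; congr (_ + _).
  rewrite /response_seq ifF ?ifF; [|lia|lia].
  by congr (_ *m A ^+ _ *m _ *m _); lia.
apply: eq_bigr => k _; rewrite /bump /= add1n addnS.
have := ltn_ord k => ltk.
by congr (response_seq _ _ _ _ _ _ *m u _); lia.
Qed.

(** The sequence satisfies the recurrence of an annihilating polynomial of [A]:
    at indices inside the window by persistency of excitation, and further on,
    where all terms are Markov parameters, by the annihilation alone.  As the
    polynomial is monic, each term is determined by the [n] preceding ones. *)
Lemma response_seq_eq0 (R : realType) (n m L T K : nat) (A : 'M[R]_n)
    (B : 'M[R]_(n, m)) (x : nat -> 'cV[R]_n) (u : nat -> 'cV[R]_m)
    (xi : 'rV[R]_n) (eta : nat -> 'rV[R]_m) :
  (0 < L)%N -> trajectory A B T x u ->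
  (n + L <= K)%N -> persistently_exciting T u K ->
  (forall t, (t < T.+1 - L)%N ->
    xi *m x t + \sum_(k < L) eta k *m u (t + k)%N = 0) ->
  forall a, response_seq A B L xi eta a = 0.
Proof.
move=> L_gt0 hxu leK hu ann0.
have shift0 := shifted_annihilator L_gt0 hxu ann0.
have [c cn1 cA] := monic_annihilator A.
set g := response_seq A B L xi eta in shift0 *.
have rec_window k : (k < n + L)%N ->
    \sum_(i < n.+1) c i *: g (n + L - 1 - k + i)%N = 0.
  apply: (persistently_exciting_eq0 (h :=
    fun k => \sum_(i < n.+1) c i *: g (n + L - 1 - k + i)%N) hu leK) => //.
  move=> t ltt.
  have comb0 : \sum_(i < n.+1) c i *: (xi *m A ^+ i *m x t +
      \sum_(k < n + L) g (n + L - 1 - k + i)%N *m u (t + k)%N) = 0.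
    apply: big1 => i _; rewrite shift0 ?scaler0 //; have := ltn_ord i; lia.
  have state0 : \sum_(i < n.+1) c i *: (xi *m A ^+ i *m x t) = 0.
    transitivity (xi *m (\sum_(i < n.+1) c i *: A ^+ i) *m x t).
      rewrite mulmx_sumr mulmx_suml; apply: eq_bigr => i _.
      by rewrite -scalemxAr -scalemxAl.
    by rewrite cA mulmx0 mul0mx.
  rewrite -[RHS]comb0.
  under [RHS]eq_bigr do rewrite scalerDr.
  rewrite big_split /= state0 add0r.
  under [RHS]eq_bigr do rewrite scaler_sumr.
  rewrite exchange_big /=; apply: eq_bigr => k' _.
  by rewrite mulmx_suml; apply: eq_bigr => i _; rewrite scalemxAl.
have rec b : \sum_(i < n.+1) c i *: g (b + i)%N = 0.
  have [ltb|leb] := ltnP b (n + L).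
    rewrite -[RHS](rec_window (n + L - 1 - b)%N); last lia.
    by apply: eq_bigr => i _; congr (_ *: g _); lia.
  transitivity (xi *m A ^+ (b - (n + L)) *m (\sum_(i < n.+1) c i *: A ^+ i) *m B).
    rewrite mulmx_sumr mulmx_suml; apply: eq_bigr => i _.
    rewrite -scalemxAr -scalemxAl; congr (_ *: _).
    rewrite -(mulmxA xi) -[A ^+ _ *m A ^+ _]exprD.
    rewrite /g /response_seq ifF ?ifF; [|lia|lia].
    by congr (_ *m A ^+ _ *m _); lia.
  by rewrite cA mulmx0 mul0mx.
elim/ltn_ind => a IHa.
have [lta|lea] := ltnP a n; first by rewrite /g /response_seq lta.
have := rec (a - n)%N; rewrite big_ord_recr /= cn1 scale1r subnK // big1 ?add0r //.
by move=> i _; rewrite IHa ?scaler0 //; have := ltn_ord i; lia.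
Qed.

Lemma data_row_free (R : realType) (n m L T K : nat) (A : 'M[R]_n)
    (B : 'M[R]_(n, m)) (x : nat -> 'cV[R]_n) (u : nat -> 'cV[R]_m) :
  controllable A B -> (0 < L)%N -> trajectory A B T x u ->
  (n + L <= K)%N -> persistently_exciting T u K ->
  row_free (col_mx (hankel1 L T x) (hankel L T u)).
Proof.
move=> hAB L_gt0 hxu leK hu.
rewrite -kermx_eq0; apply/eqP/row_matrixP => r; rewrite row0.
have : row r (kermx (col_mx (hankel1 L T x) (hankel L T u))) *m
    col_mx (hankel1 L T x) (hankel L T u) = 0.
  by rewrite -row_mul mulmx_ker row0.
move: (row r _) => v; rewrite -[v]hsubmxK mul_row_col.
set xi := lsubmx v; set w := rsubmx v => v0.
pose eta k : 'rV[R]_m := if insub k is Some k' then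
  \row_i w 0 (mxtens_index (k' : 'I_L, i)) else 0.
have etaE (k : 'I_L) : eta k = \row_i w 0 (mxtens_index (k, i)).
  by rewrite /eta valK.
have ann0 t : (t < T.+1 - L)%N ->
    xi *m x t + \sum_(k < L) eta k *m u (t + k)%N = 0.
  move=> ltt; have /rowP/(_ (Ordinal ltt)) := v0; rewrite !mxE => v0t.
  apply/matrixP => i j; rewrite !ord1 !mxE summxE -[RHS]v0t; congr (_ + _).
    by apply: eq_bigr => l _; rewrite !mxE.
  rewrite [RHS]sum_mxtens_index.
  apply: eq_bigr => a _; rewrite etaE !mxE.
  by apply: eq_bigr => b _; rewrite !mxE mxtens_indexK.
have g0 := response_seq_eq0 L_gt0 hxu leK hu ann0.
have -> : xi = 0.
  apply: (markov_eq0 hAB) => j.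
  rewrite -[RHS](g0 (n + L + j)%N) /response_seq ifF ?ifF; [|lia|lia].
  by rewrite addKn.
suff -> : w = 0 by rewrite row_mx0.
apply/rowP => q; rewrite mxE -[q]mxtens_unindexK.
case: (mxtens_unindex q) => k i.
have := g0 (n + L - 1 - k)%N; rewrite /response_seq.
have ltk := ltn_ord k; rewrite ifF ?ifT; [|lia|lia].
rewrite (_ : (n + L - 1 - (n + L - 1 - k) = k)%N); last lia.
by rewrite etaE => /rowP/(_ i); rewrite !mxE.
Qed.

(** * The block shift *)

Lemma downshift_blkdiag_mulE (R : realType) (L n m q : nat) (M : 'M[R]_(n, m))
    (V : 'M[R]_(L * m, q)) (k : 'I_L) (i : 'I_n) (j : 'I_q) :
  (downshift R L n *m blkdiag L M *m V) (mxtens_index (k, i)) j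
  = \sum_(k' < L) (k == k'.+1 :> nat)%:R *
      \sum_(l < m) M i l * V (mxtens_index (k', l)) j.
Proof.
rewrite /downshift /blkdiag tensmx_mul mulmx1 mul1mx mxE.
rewrite sum_mxtens_index.
apply: eq_bigr => a _; rewrite mulr_sumr; apply: eq_bigr => b _.
by rewrite tensmxE mxE mulrA.
Qed.

Lemma downshift_blkdiag_mul0 (R : realType) (L n m q : nat) (M : 'M[R]_(n, m))
    (V : 'M[R]_(L * m, q)) (k : 'I_L) (i : 'I_n) (j : 'I_q) :
  k = 0%N :> nat ->
  (downshift R L n *m blkdiag L M *m V) (mxtens_index (k, i)) j = 0.
Proof.
move=> k0; rewrite downshift_blkdiag_mulE big1 // => k' _.
by rewrite k0 mul0r.
Qed.

Lemma downshift_blkdiag_mulS (R : realType) (L n m q : nat) (M : 'M[R]_(n, m))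
    (V : 'M[R]_(L * m, q)) (k k' : 'I_L) (i : 'I_n) (j : 'I_q) :
  k = k'.+1 :> nat ->
  (downshift R L n *m blkdiag L M *m V) (mxtens_index (k, i)) j
  = \sum_(l < m) M i l * V (mxtens_index (k', l)) j.
Proof.
move=> kS; rewrite downshift_blkdiag_mulE (bigD1 k') //= kS eqxx mul1r.
rewrite [X in _ + X]big1 ?addr0 // => a nak'.
by rewrite eqSS eq_sym (inj_eq val_inj) (negPf nak') mul0r.
Qed.

(** The operator [Z A] is nilpotent: its value in one block depends on the
    preceding block only, so blocks of a fixed point vanish one after the
    other. *)
Lemma shift_fixed_eq0 (R : realType) (L n q : nat) (A : 'M[R]_n)
    (W : 'M[R]_(L * n, q)) :
  downshift R L n *m blkdiag L A *m W = W -> W = 0.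
Proof.
move=> fixW; apply/matrixP => r j; rewrite mxE -[r]mxtens_unindexK.
case: (mxtens_unindex r) => -[k ltk] i.
elim: k ltk i => [|k IHk] ltk i; rewrite -fixW.
  by rewrite downshift_blkdiag_mul0.
rewrite (downshift_blkdiag_mulS _ _ (k' := Ordinal (ltnW ltk))) //.
by apply: big1 => l _; rewrite IHk mulr0.
Qed.

Lemma hankel_dynamics (R : realType) (n m L T : nat) (A : 'M[R]_n)
    (B : 'M[R]_(n, m)) (x : nat -> 'cV[R]_n) (u : nat -> 'cV[R]_m) :
  trajectory A B T x u ->
  hankel L T x = downshift R L n *m blkdiag L A *m hankel L T x
    + downshift R L n *m blkdiag L B *m hankel L T u
    + id_blockcol0 R L n *m hankel1 L T x.
Proof.
move=> hxu; apply/matrixP => r t; rewrite -[r]mxtens_unindexK.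
case: (mxtens_unindex r) => -[k ltk] i.
rewrite [RHS]mxE [in RHS]mxE.
have -> : (id_blockcol0 R L n *m hankel1 L T x)
    (mxtens_index (Ordinal ltk, i)) t = (k == 0%N)%:R * x t i 0.
  rewrite mxE.
  case: k ltk => [|k] ltk.
    rewrite (bigD1 i) //= !mxE /= mul0n add0n eqxx big1 ?addr0 // => l nli.
    by rewrite !mxE /= mul0n add0n eq_sym (inj_eq val_inj) (negPf nli) mul0r.
  rewrite mul0r big1 // => l _; rewrite !mxE /=.
  rewrite (_ : (_ == _) = false) ?mul0r //.
  apply/negbTE/eqP => /=; have := ltn_ord l; have := ltn_ord i; nia.
rewrite [LHS]mxE mxtens_indexK /=.
case: k ltk => [|k] ltk.
  by rewrite !downshift_blkdiag_mul0 // !add0r mul1r addn0.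
rewrite mul0r addr0.
rewrite !(downshift_blkdiag_mulS _ _ (k' := Ordinal (ltnW ltk))) //.
have ltt := ltn_ord t.
rewrite addnS hxu; last lia.
rewrite !mxE; congr (_ + _); apply: eq_bigr => l _;
  by rewrite !mxE mxtens_indexK.
Qed.

(** * Trajectories from data *)

Theorem theorem2 (R : realType) (n m L T K : nat)
  (A : 'M[R]_n) (B : 'M[R]_(n, m))
  (x : nat -> 'cV[R]_n) (u : nat -> 'cV[R]_m)
  (hAB : controllable A B)
  (hL : (0 < L)%N)
  (hxu : trajectory A B T x u)
  (hK : (n + L <= K)%N)
  (hu : persistently_exciting T u K) :
  [set col_mx Phi.1 Phi.2 | Phi in
    [set Phi : 'M[R]_(L * n, n) * 'M[R]_(L * m, n) |
      row_mx (1%:M - downshift R L n *m blkdiag L A)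
             (- (downshift R L n *m blkdiag L B)) *m col_mx Phi.1 Phi.2
      = id_blockcol0 R L n]]
  = [set col_mx (hankel L T x) (hankel L T u) *m G | G in Gamma L T x].
Proof.
pose ZA := downshift R L n *m blkdiag L A.
pose ZB := downshift R L n *m blkdiag L B.
have constraintE (Px : 'M[R]_(L * n, n)) (Pu : 'M[R]_(L * m, n)) :
    row_mx (1%:M - ZA) (- ZB) *m col_mx Px Pu = Px - ZA *m Px - ZB *m Pu.
  by rewrite mul_row_col mulmxBl mul1mx mulNmx.
have data_solution G : Gamma L T x G ->
    hankel L T x *m G - ZA *m (hankel L T x *m G) - ZB *m (hankel L T u *m G)
    = id_blockcol0 R L n.
  move=> hG; rewrite {1}(hankel_dynamics L hxu).
  rewrite !mulmxDl -(mulmxA (id_blockcol0 R L n)) hG mulmx1 -/ZA -/ZB.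
  by rewrite !mulmxA -addrA -opprD [_ + id_blockcol0 R L n]addrC addrK.
apply/seteqP; split => [_ [[Px Pu] /= hPhi <-]|_ [G hG <-]]; last first.
  exists (hankel L T x *m G, hankel L T u *m G) => /=; last first.
    by rewrite mul_col_mx.
  by rewrite constraintE data_solution.
have /row_freeP [D hD] := data_row_free hAB hL hxu hK hu.
(* This [G] combines the data windows so as to start at the identity and to
   have the inputs [Pu]; the states then agree by uniqueness. *)
have : col_mx (hankel1 L T x) (hankel L T u) *m (D *m col_mx 1%:M Pu)
    = col_mx 1%:M Pu by rewrite mulmxA hD mul1mx.
rewrite mul_col_mx => /eq_col_mx [hG hGu].
exists (D *m col_mx 1%:M Pu) => //.
rewrite mul_col_mx hGu; congr col_mx.
apply/eqP; rewrite -subr_eq0; apply/eqP/shift_fixed_eq0.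
rewrite -/ZA mulmxBr.
move: hPhi (data_solution _ hG); rewrite constraintE hGu => <-.
move/addIr/eqP; rewrite subr_eq => /eqP eqX.
by rewrite [in RHS]eqX [RHS]addrC !addrA addNr add0r addrC.
Qed.
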